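(* Let $n\ge2$, let $\varepsilon,\delta,\beta\ge0$ and let $\alpha\in[1,1+\frac1{n-1})$. Let $1\le p<\frac{n}{n-\alpha(n-1)}$. Let $\varphi:(0,\infty)\to\mathbb{R}$ and $H:[0,\infty)\to\mathbb{R}$ be the functions $$\varphi(t)=\frac{t^\alpha}{\log^\beta(e+t^{-1})}$$ and $$H(t)=\left(\frac{t}{\log^{\beta(n-1)-\delta}(m+t)}\right)^{\frac{np}{\alpha p(n-1)+n(1-p)}+\varepsilon},$$ where $m\ge e$. If $\varepsilon>0$ or $\delta>0$, then there exist a constant $C$ and a sequence of functions $(u_k)$ in $L^p(\mathbb{R}^n)$ such that $\|u_k\|_{L^p(\mathbb{R}^n)}\le C$ for every $k$ and $$\int_{\mathbb{R}^n}H\left(\int_{\mathbb{R}^n}\frac{|u_k(z)|}{\varphi(|x-z|)^{n-1}}\,dz\right)dx\to\infty\quad\text{as } k\to\infty .$$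
   Context: $\log^{s}(\cdot)$ denotes $(\log(\cdot))^{s}$. *)

(* Defs.v *)
From HB Require Import structures.
From mathcomp Require Import all_boot all_order all_algebra.
From mathcomp Require Import all_classical all_reals all_analysis.
Set Implicit Arguments.
Unset Strict Implicit.
Unset Printing Implicit Defensive.
Import Order.TTheory GRing.Theory Num.Theory.
Import numFieldNormedType.Exports.
Local Open Scope classical_set_scope.
Local Open Scope ring_scope.

(* R^n, with the product of the Borel sigma-algebras of its coordinates. *)
Notation Rn R n := (n.-tuple (measurableTypeR R)).

Section lebesgue_Rn.
Context {R : realType}.

Definition cons_Rn n (x : measurableTypeR R * Rn R n) : Rn R n.+1 :=
  [the n.+1.-tuple (measurableTypeR R) of x.1 :: x.2].

Definition uncons_Rn n (x : Rn R n.+1) : measurableTypeR R * Rn R n :=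
  (tnth x ord0, [tuple of behead x]).

Lemma cons_RnK n : cancel (@cons_Rn n) (@uncons_Rn n).
Proof. by case=> a t; congr (_, _); exact/val_inj. Qed.

Lemma measurable_cons_Rn n : measurable_fun [set: _] (@cons_Rn n).
Proof. exact: measurable_cons. Qed.

HB.instance Definition _ n :=
  isMeasurableFun.Build _ _ _ _ (@cons_Rn n) (@measurable_cons_Rn n).

Lemma measurable_uncons_Rn n : measurable_fun [set: _] (@uncons_Rn n).
Proof.
apply/measurable_fun_pair; first exact: measurable_tnth.
exact: measurable_behead.
Qed.

Section step.
Context (n : nat) (mu : {sigma_finite_measure set (Rn R n) -> \bar R}).

Definition lebesgue_Rn_step : set (Rn R n.+1) -> \bar R :=
  pushforward (lebesgue_measure \x mu)%E (@cons_Rn n).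

Let step0 : lebesgue_Rn_step set0 = 0%E.
Proof. exact: measure0. Qed.

Let step_ge0 A : (0 <= lebesgue_Rn_step A)%E.
Proof. exact: measure_ge0. Qed.

Let step_sigma_additive : semi_sigma_additive lebesgue_Rn_step.
Proof. exact: measure_semi_sigma_additive. Qed.

HB.instance Definition _ := isMeasure.Build _ _ _ lebesgue_Rn_step
  step0 step_ge0 step_sigma_additive.

Let step_sigma_finite : sigma_finite [set: _] lebesgue_Rn_step.
Proof.
have /sigma_finiteP[F [FT ndF Foo]] := sigma_finiteT (@lebesgue_measure R).
have /sigma_finiteP[G [GT ndG Goo]] := sigma_finiteT mu.
exists (fun i => @uncons_Rn n @^-1` (F i `*` G i)) => [|i].
  apply/seteqP; split=> // x _.
  have [i _ Fi] : (\bigcup_i F i) (uncons_Rn x).1 by rewrite -FT.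
  have [j _ Gj] : (\bigcup_i G i) (uncons_Rn x).2 by rewrite -GT.
  exists (maxn i j) => //; split.
  - by move: Fi; exact/subsetPset/ndF/leq_maxl.
  - by move: Gj; exact/subsetPset/ndG/leq_maxr.
have [mF Fioo] := Foo i; have [mG Gioo] := Goo i.
split.
  rewrite -[X in measurable X]setTI.
  by apply: measurable_uncons_Rn => //; exact: measurableX.
rewrite /lebesgue_Rn_step /pushforward -comp_preimage.
rewrite (_ : _ \o _ = id); last exact/funext/cons_RnK.
by rewrite preimage_id product_measure1E// lte_mul_pinfty// ge0_fin_numE.
Qed.

HB.instance Definition _ :=
  Measure_isSigmaFinite.Build _ _ _ lebesgue_Rn_step step_sigma_finite.

End step.

Fixpoint lebesgue_Rn n : {sigma_finite_measure set (Rn R n) -> \bar R} :=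
  if n is n'.+1 then lebesgue_Rn_step (lebesgue_Rn n')
  else dirac ([tuple] : Rn R 0).

Lemma lebesgue_Rn_box n (A : 'I_n -> set (measurableTypeR R)) :
  (forall i, measurable (A i)) ->
  lebesgue_Rn n [set x | forall i, A i (tnth x i)] =
  (\prod_(i < n) lebesgue_measure (A i))%E.
Proof.
elim: n A => [|n IH] A mA.
  rewrite big_ord0 /= diracE mem_set//; by case.
rewrite big_ord_recl /= /lebesgue_Rn_step /pushforward.
rewrite -(IH _ (fun i => mA (lift ord0 i))) -product_measure1E//.
  congr (_ _); apply/seteqP; split=> -[a t] /=.
    move=> h; split; first exact: (h ord0).
    by move=> i; have := h (lift ord0 i); rewrite tnthS.
  by move=> [Aa h] i; have [j ->|->//] := unliftP ord0 i; rewrite tnthS.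
rewrite (_ : [set _ | _] =
    \bigcap_i ((fun x : Rn R n => tnth x i) @^-1` A (lift ord0 i))).
  apply: fin_bigcap_measurable => // i _.
  by rewrite -[X in measurable X]setTI; exact: measurable_tnth.
by apply/seteqP; split=> x /= h i; [move=> _|]; exact: h.
Qed.

End lebesgue_Rn.

Section functions.
Context {R : realType}.

Definition edist n (x z : Rn R n) : R :=
  Num.sqrt (\sum_(i < n) ((tnth x i : R) - tnth z i) ^+ 2).

Definition phi (alpha beta t : R) : R :=
  t `^ alpha / ln (expR 1 + t^-1) `^ beta.

Definition Hfun (n : nat) (alpha beta delta eps p m t : R) : R :=
  (t / ln (m + t) `^ (beta * (n%:R - 1) - delta)) `^
    (n%:R * p / (alpha * p * (n%:R - 1) + n%:R * (1 - p)) + eps).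

(* The integral in z, with values in [0, +oo]; the integrand on the Lebesgue-null
   set {z = x}, where phi is not meant to be evaluated, is irrelevant. *)
Definition potential (n : nat) (alpha beta : R) (u : Rn R n -> R) (x : Rn R n)
    : \bar R :=
  (\int[lebesgue_Rn n]_z (`|u z| / phi alpha beta (edist x z) ^+ n.-1)%:E)%E.

(* er_map extends Hfun to [0, +oo] by its limit H(+oo) = +oo. *)
Definition Hintegral (n : nat) (alpha beta delta eps p m : R) (u : Rn R n -> R)
    : \bar R :=
  (\int[lebesgue_Rn n]_x
     er_map (Hfun n alpha beta delta eps p m) (potential alpha beta u x))%E.

End functions.

(* Main.v *)
Require Import Defs.
From mathcomp Require Import all_boot all_order all_algebra.
From mathcomp Require Import all_classical all_reals all_analysis.
From mathcomp Require Import measurable_realfun ring lra.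
Import Order.TTheory GRing.Theory Num.Theory.
Import numFieldNormedType.Exports.
Local Open Scope classical_set_scope.
Local Open Scope ring_scope.

Set Implicit Arguments.
Unset Strict Implicit.
Unset Printing Implicit Defensive.

(** For [eps = delta = 0] the growth of [Hfun] balances the concentration of
    bumps at the origin: a bump of norm [1] contributes an amount that stays
    bounded below at every scale.  Any excess in [Hfun] turns this balance into
    divergence as the scale shrinks.

    Take [u] of height [c] on the cube of side [l] with lower corner [0], and
    [0] elsewhere, where [l = expR (- s) / (2 n)] with [s >= 1], and
    [c = l^(- n / p)], so that the [L^p] norm of [u] is [1].  For [x] in the
    reflected cube and [z] in the support of [u], the distance [t] from [x] to
    [z] satisfies
    [0 < t <= expR (- s)]; hence [1 / phi t >= expR (alpha s) * s^beta], because
    the logarithm in [phi] is at least [s] ([phi_bounds]).  Integrating over the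
    support gives ([potential_bump_ge], [bump_height])

      potential of [u] at [x] >= c1 * expR (A s) * s^(beta (n - 1)),

    where [A = alpha (n - 1) + n / p - n] is positive by the bound on [p].

    For [P] above this bound, the logarithm in [Hfun] may be replaced by [s] up
    to constants, so the powers [s^(beta (n - 1))] cancel and [s^delta] is left:
    [P / ln (m + P)^(beta (n - 1) - delta) >= c' * expR (A s) * s^delta]
    ([div_ln_ge]).  The exponent of [Hfun] is [q = n / A + eps], so the [q]-th
    power is at least a constant times
    [expR (n s) * expR (A eps s) * s^(delta q)].  The volume [l^n] of the
    reflected cube cancels [expR (n s)], and [expR (A eps s) * s^(delta q)] tends to
    infinity with [s] as soon as [eps] or [delta] is positive
    ([powR_div_ln_ge], [mulr_powR_eventually_ge]).  The sequence is obtained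
    with [s = k]. *)

(** * Lower bounds for integrals *)

Section lower_bound.
Import HBNNSimple.

(** The integral of a nonnegative function is the supremum of the integrals of
    the simple functions below it, and [c * \1_A] is one of them.  In this form
    the bound applies to the kernel and to the nonlinear function of the
    potential without a detour through Tonelli's theorem. *)
Lemma ge0_integral_ge_cst d (T : measurableType d) (R : realType)
    (mu : {measure set T -> \bar R}) (f : T -> \bar R) (A : set T) (c : R) :
  measurable A -> 0 <= c -> (forall x, 0 <= f x)%E ->
  (forall x, A x -> c%:E <= f x)%E -> (c%:E * mu A <= \int[mu]_x f x)%E.
Proof.
move=> mA c0 f0 cf; rewrite ge0_integralTE//.
apply: le_ereal_sup_tmp.
exists (sintegral mu (scale_nnsfun (indic_nnsfun R mA) c0)).
  exists (scale_nnsfun (indic_nnsfun R mA) c0) => //= x.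
  rewrite [X in c * X](_ : _ = \1_A x)// indicE.
  have [/set_mem xA|_] := boolP (x \in A).
    by rewrite mulr1 cf.
  by rewrite mulr0 f0.
by rewrite sintegralrM sintegral_indic.
Qed.

End lower_bound.

(** * Cubes *)

Section cube.
Context {R : realType} (n : nat).
Implicit Types a b : R.

Definition cube a b : set (Rn R n) :=
  [set x | forall i, [set` `]a, b]] (tnth x i : R)].

Lemma measurable_cube a b : measurable (cube a b).
Proof.
rewrite (_ : cube a b =
    \bigcap_i ((fun x : Rn R n => tnth x i) @^-1` [set` `]a, b]])).
  apply: fin_bigcap_measurable => // i _.
  by rewrite -[X in measurable X]setTI; exact: measurable_tnth.
by apply/seteqP; split=> x /= h i; [move=> _|]; exact: h.
Qed.

Lemma lebesgue_cube a b : a <= b ->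
  lebesgue_Rn n (cube a b) = ((b - a) ^+ n)%:E.
Proof.
move=> ab; rewrite (lebesgue_Rn_box (A := fun=> [set` `]a, b]]))//.
under eq_bigr do rewrite lebesgue_measure_itv/= lte_fin.
have -> : (if (a < b)%R then b%:E - a%:E else 0)%E = (b - a)%:E.
  case: ltP => // ba; rewrite (_ : b = a) ?subrr//.
  by apply/eqP; rewrite eq_le ab ba.
by rewrite prodEFin prodr_const card_ord.
Qed.

(** Using two disjoint cubes keeps [x] and [z] apart, so that the singularity of
    the kernel on the diagonal never has to be discussed.  The bound is the
    crude one, [sqrt n <= n] times the side [2 l] of the union of the cubes. *)
Lemma edist_cubes (l : R) (x z : Rn R n) : (0 < n)%N ->
  cube (- l) 0 x -> cube 0 l z -> 0 < Defs.edist x z <= 2 * n%:R * l.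
Proof.
move=> n0 xQ zQ.
have xz i : 0 < (tnth z i : R) - tnth x i <= 2 * l.
  move: (xQ i) (zQ i); rewrite /= !in_itv/=; lra.
have l0 : 0 < l by have := xz (Ordinal n0); lra.
rewrite /Defs.edist; apply/andP; split.
  rewrite sqrtr_gt0 (bigD1 (Ordinal n0))//=.
  rewrite ltr_pwDl ?sumr_ge0// => [|i _]; last exact: sqr_ge0.
  rewrite exprn_even_gt0//= subr_eq0; have := xz (Ordinal n0).
  by case: eqP => // ->; rewrite subrr ltxx.
have n1 : 1 <= n%:R :> R by rewrite ler1n.
have H : 0 <= 2 * n%:R * l by nra.
rewrite -[leRHS]ger0_norm// -[leRHS]sqrtr_sqr ler_sqrt ?sqr_ge0//.
apply: (@le_trans _ _ (\sum_(i < n) (2 * l) ^+ 2)).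
  apply: ler_sum => i _; rewrite -sqrrN opprB.
  by have := xz i; rewrite !expr2; nra.
rewrite sumr_const card_ord -[leLHS]mulr_natl.
rewrite [leRHS](_ : _ = n%:R ^+ 2 * (2 * l) ^+ 2); last by ring.
by apply: ler_wpM2r; rewrite ?sqr_ge0// expr2; nra.
Qed.

End cube.

(** * The potential of a bump *)

(** With the distance measured as [expR (- s)], the logarithm
    [ln (expR 1 + t^-1)] is bounded below by [ln (expR s) = s]. *)
Lemma phi_bounds (R : realType) (alpha beta t s : R) :
  0 <= alpha -> 0 <= beta -> 1 <= s -> 0 < t <= expR (- s) ->
  0 < phi alpha beta t <= (expR (alpha * s) * s `^ beta)^-1.
Proof.
move=> a0 b0 s1 /andP[t0 ts]; rewrite /phi.
have ti : expR s <= t^-1.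
  by rewrite -[leLHS]invrK -expRN lef_pV2 ?posrE ?expR_gt0.
have Lk : s <= ln (expR 1 + t^-1).
  rewrite -[leLHS]expRK ler_ln ?posrE ?expR_gt0//.
    by rewrite ler_wpDl// expR_ge0.
  by rewrite addr_gt0 ?expR_gt0 ?invr_gt0.
have s0 : 0 < s by lra.
rewrite divr_gt0 ?powR_gt0//=; last exact: lt_le_trans Lk.
rewrite invfM -expRN ler_pM ?powR_ge0 ?invr_ge0 ?powR_ge0//.
  rewrite mulrC -mulNr expRM ge0_ler_powR// ?nnegrE ?expR_ge0//; exact: ltW.
rewrite lef_pV2 ?posrE ?powR_gt0//; last exact: lt_le_trans Lk.
by rewrite ge0_ler_powR// ?nnegrE ?(ltW s0)// (le_trans _ Lk)// ltW.
Qed.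

Section bump.
Context {R : realType} (n : nat).

Definition bump (c l : R) (z : Rn R n) : R := c * \1_(@cube R n 0 l) z.

Lemma measurable_bump c l : measurable_fun setT (bump c l).
Proof.
apply: measurable_funM => //; apply: measurable_indic.
exact: measurable_cube.
Qed.

Lemma Lnorm_bump c l p : 1 <= p -> 0 <= c -> 0 <= l ->
  ('N[lebesgue_Rn n]_p%:E[EFin \o bump c l] = (c * (l ^+ n) `^ p^-1)%:E)%E.
Proof.
move=> p1 c0 l0; rewrite unlock.
have p0 : p != 0 by rewrite gt_eqF//; lra.
under eq_integral => z _.
  rewrite /bump /= normrM (ger0_norm c0) powRM//.
  rewrite (_ : `| _ | `^ p = \1_(@cube R n 0 l) z); last first.
    rewrite indicE; case: (_ \in _); first by rewrite normr1 powR1.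
    by rewrite normr0 powR0.
  rewrite EFinM; over.
rewrite ge0_integralZl_EFin//; first last.
  exact: powR_ge0.
  by apply/measurable_EFinP; apply: measurable_indic; exact: measurable_cube.
rewrite integral_indic//; last exact: measurable_cube.
rewrite setIT [X in (_ * X)%E](lebesgue_cube _ l0)// subr0 -EFinM poweR_EFin.
rewrite powRM ?powR_ge0 ?exprn_ge0//.
by rewrite -powRrM mulfV// powRr1.
Qed.

Lemma Lfun_bump c l p : 1 <= p -> 0 <= c -> 0 <= l ->
  bump c l \in Lfun (lebesgue_Rn n) p%:E.
Proof.
move=> p1 c0 l0; rewrite inE/=; apply/andP; split; rewrite inE/=.
  exact: measurable_bump.
by rewrite /finite_norm Lnorm_bump// ltry.
Qed.

Lemma potential_ge0 alpha beta u (x : Rn R n) :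
  (0 <= potential alpha beta u x)%E.
Proof.
apply: integral_ge0 => z _; rewrite lee_fin divr_ge0// exprn_ge0//.
by rewrite /phi divr_ge0 ?powR_ge0.
Qed.

(** The side [l] is the one for which [edist_cubes] bounds the distances by
    [expR (- s)]; the three factors are the height of the bump, the lower bound
    of the kernel and the volume of the cube. *)
Lemma potential_bump_ge (alpha beta c s : R) (x : Rn R n) :
  (0 < n)%N -> 0 <= alpha -> 0 <= beta -> 0 <= c -> 1 <= s ->
  let l := expR (- s) / (2 * n%:R) in
  cube (- l) 0 x ->
  ((c * (expR (alpha * s) * s `^ beta) ^+ n.-1 * l ^+ n)%:E <=
   potential alpha beta (bump c l) x)%E.
Proof.
move=> n0 a0 b0 c0 s1 l xQ.
have n1 : 1 <= n%:R :> R by rewrite ler1n.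
have l0 : 0 <= l by rewrite divr_ge0 ?expR_ge0//; lra.
rewrite EFinM -[l]subr0 -lebesgue_cube// subr0.
apply: ge0_integral_ge_cst => [||z|z zQ].
- exact: measurable_cube.
- by rewrite mulr_ge0// exprn_ge0// mulr_ge0 ?expR_ge0 ?powR_ge0.
- rewrite lee_fin divr_ge0// exprn_ge0//.
  by rewrite /phi divr_ge0 ?powR_ge0.
have /andP[d0 dl] := edist_cubes n0 xQ zQ.
have dS : 0 < Defs.edist x z <= expR (- s).
  rewrite d0 (le_trans dl)// /l mulrC divfK//; lra.
have /andP[p0 pl] := phi_bounds a0 b0 s1 dS.
rewrite lee_fin /bump indicE mem_set// mulr1 ger0_norm//.
have s0 : 0 < s by lra.
have Es0 : 0 < expR (alpha * s) * s `^ beta.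
  by rewrite mulr_gt0 ?expR_gt0 ?powR_gt0.
rewrite ler_wpM2l// -exprVn lerXn2r ?nnegrE ?invr_ge0 ?(ltW p0) ?(ltW Es0)//.
by rewrite -[leLHS]invrK lef_pV2// posrE invr_gt0.
Qed.

End bump.

(** The height [(l ^+ n) `^ (- p^-1)] is the one that gives the bump norm [1] in
    [L^p].  The lower bound of its potential separates into an exponential of
    [s], a power of [s] and a constant. *)
Lemma bump_height (R : realType) (n : nat) (alpha beta p s : R) :
  (0 < n)%N -> 1 <= p -> 0 < s ->
  let l := expR (- s) / (2 * n%:R) in
  let w := ((2 * n%:R)^-1) ^+ n in
  (l ^+ n) `^ (- p^-1) * (expR (alpha * s) * s `^ beta) ^+ n.-1 * l ^+ n =
  w `^ (- p^-1) * w *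
  expR ((alpha * p * (n%:R - 1) + n%:R * (1 - p)) / p * s) *
  s `^ (beta * (n%:R - 1)).
Proof.
move=> n0 p1 s0 l w.
have n1 : 1 <= n%:R :> R by rewrite ler1n.
have lE : l ^+ n = expR (- n%:R * s) * w.
  by rewrite /l exprMn -expRM_natl mulrN mulNr.
have w0 : 0 <= w by rewrite exprn_ge0// invr_ge0; lra.
have nE : n.-1%:R = n%:R - 1 :> R by rewrite -subn1 natrB.
rewrite lE powRM ?expR_ge0// -expRM exprMn -expRM_natl nE.
rewrite -(powR_mulrn _ (powR_ge0 _ _)) -powRrM nE.
have -> : (alpha * p * (n%:R - 1) + n%:R * (1 - p)) / p * s =
    - n%:R * s * - p^-1 + ((n%:R - 1) * (alpha * s) + - n%:R * s).
  by field; rewrite gt_eqF//; lra.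
by rewrite !expRD; ring.
Qed.

(** * Growth of the nonlinearity *)

Section growth.
Context {R : realType}.
Implicit Types a b c A M s P lam : R.

Lemma ln_le_powR a lam : 0 < a -> 0 < lam -> ln lam <= a * lam `^ a^-1.
Proof.
move=> a0 l0; have -> : ln lam = a * ln (lam `^ a^-1).
  by rewrite ln_powR mulVKf// gt_eqF.
by rewrite ler_wpM2l ?(ltW a0)// ltW// ln_sublinear// powR_gt0.
Qed.

(** A substitute for the monotonicity of [t / ln (m + t) `^ a], which can fail
    for large [a].  Multiplying the argument [T = c * expR (A * s) * s `^ b] by
    [lam >= 1] adds at most [ln lam <= a * lam `^ a^-1] to the logarithm, so its
    [a]-th power grows at most linearly in [lam]; and [ln (m + T)] is at most
    a constant times [s]. *)
Lemma ln_shift_powR_le a b A c m :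
  0 < a -> 0 <= b -> 0 <= A -> 0 < c -> 1 <= m ->
  exists2 M, 0 < M & forall s lam, 1 <= s -> 1 <= lam ->
    ln (m + lam * (c * expR (A * s) * s `^ b)) `^ a <= M * (s `^ a * lam).
Proof.
move=> a0 b0 A0 c0 m1.
pose N := ln (m + c) + A + b + a.
have N0 : 0 < N by have := ln_ge0 (_ : 1 <= m + c); rewrite /N; lra.
exists (N `^ a); first exact: powR_gt0.
move=> s lam s1 l1.
have [s0 l0] : 0 < s /\ 0 < lam by lra.
set P := lam * _.
have P0 : 0 <= P by rewrite !mulr_ge0 ?expR_ge0 ?powR_ge0 ?(ltW c0) ?(ltW l0).
have mP1 : 1 <= m + P by lra.
have mP : m + P <= lam * ((m + c) * expR ((A + b) * s)).
  (* since [s <= expR s] *)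
  have sb : s `^ b <= expR (b * s).
    rewrite mulrC expRM ge0_ler_powR ?nnegrE ?expR_ge0 ?(ltW s0)//.
    by have := expR_ge1Dx s; lra.
  have E1 : 1 <= expR ((A + b) * s).
    by rewrite -[leLHS]expR0 ler_expR mulr_ge0//; lra.
  have PE : P <= lam * (c * expR ((A + b) * s)).
    rewrite /P mulrDl expRD -(mulrA c) ler_wpM2l ?(ltW l0)//.
    by rewrite ler_wpM2l ?(ltW c0)// ler_wpM2l ?expR_ge0.
  rewrite mulrDl mulrDr lerD// -[leLHS]mul1r ler_pM//; first lra.
  by rewrite -[leLHS]mulr1 ler_wpM2l//; lra.
have mc : 0 < m + c by lra.
have lnP : ln (m + P) <= N * (s * lam `^ a^-1).
  apply: le_trans (_ : ln (lam * ((m + c) * expR ((A + b) * s))) <= _).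
    by rewrite ler_ln// posrE ?mulr_gt0 ?expR_gt0//; lra.
  rewrite !lnM ?posrE ?mulr_gt0 ?expR_gt0// expRK.
  have la := ln_le_powR a0 l0.
  have la1 : 1 <= lam `^ a^-1.
    by rewrite -[leLHS](powRr0 lam) ler_powR// invr_ge0 ltW.
  have lnmc : 0 <= ln (m + c) by apply: ln_ge0; lra.
  rewrite /N; set y := lam `^ _ in la la1 *; set L := ln (m + c) in lnmc *.
  have sy : 1 <= s * y by nra.
  have h1 : L <= L * (s * y) by nra.
  have h2 : (A + b) * s <= (A + b) * (s * y).
    by rewrite ler_wpM2l//; [lra|nra].
  have h3 : a * y <= a * (s * y) by rewrite ler_wpM2l ?(ltW a0)//; nra.
  rewrite !mulrDl in h2 *; lra.
apply: (@le_trans _ _ ((N * (s * lam `^ a^-1)) `^ a)).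
  rewrite ge0_ler_powR ?nnegrE ?ln_ge0 ?(ltW a0)//.
  by rewrite !mulr_ge0 ?powR_ge0 ?(ltW N0) ?(ltW s0).
rewrite powRM ?(ltW N0) ?mulr_ge0 ?powR_ge0 ?(ltW s0)//.
rewrite powRM ?powR_ge0 ?(ltW s0)// -powRrM mulVf ?gt_eqF// powRr1//.
exact: ltW.
Qed.

(** Along [P >= T = c * expR (A * s) * s `^ b] the logarithm may be replaced by
    [s].  If [b > delta] it must be bounded above although [P] may be much
    larger than [T], which is the purpose of [ln_shift_powR_le] applied to
    [lam = P / T].  If [b <= delta] it sits in the numerator, and
    [ln (m + P) >= A / 2 * s] suffices. *)
Lemma div_ln_ge b delta A c m : 0 <= b -> 0 < A -> 0 < c -> 1 <= m ->
  exists c' K, [/\ 0 < c', 1 <= K & forall s P, K <= s ->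
    c * expR (A * s) * s `^ b <= P ->
    c' * (expR (A * s) * s `^ delta) <= P / ln (m + P) `^ (b - delta)].
Proof.
move=> b0 A0 c0 m1; have [a0|a0] := ltP 0 (b - delta).
  have [M M0 HM] := ln_shift_powR_le a0 b0 (ltW A0) c0 m1.
  exists (c / M), 1; split => //; first exact: divr_gt0.
  move=> s P s1; set T := c * _ * _ => TP.
  have s0 : 0 < s by lra.
  have T0 : 0 < T by rewrite !mulr_gt0 ?expR_gt0 ?powR_gt0.
  have := HM s (P / T) s1; rewrite -/T divfK ?gt_eqF// ler_pdivlMr// mul1r.
  move=> /(_ TP) lnP.
  have mP : 1 < m + P by lra.
  rewrite ler_pdivlMr ?powR_gt0 ?ln_gt0//.
  apply: (le_trans (ler_wpM2l _ lnP)).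
    by rewrite !mulr_ge0 ?invr_ge0 ?expR_ge0 ?powR_ge0 ?(ltW M0) ?(ltW c0).
  rewrite (@powRB _ s b delta); last by rewrite (gt_eqF s0) implybT.
  rewrite /T le_eqVlt; apply/orP; left; apply/eqP.
  by field; rewrite !gt_eqF ?powR_gt0 ?expR_gt0.
(* From [K] on, [ln c >= - (A / 2) * s], so [ln (c * expR (A * s))] is at least
   [A / 2 * s]. *)
pose K := Num.max 1 (- (2 * ln c) / A).
exists (c * (A / 2) `^ (delta - b)), K; split.
- by rewrite mulr_gt0// powR_gt0// divr_gt0.
- by rewrite le_max lexx.
move=> s P; rewrite ge_max => /andP[s1 sc] TP.
have s0 : 0 < s by lra.
have sb1 : 1 <= s `^ b by rewrite -[leLHS](powRr0 s) ler_powR.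
have cE0 : 0 < c * expR (A * s) by rewrite mulr_gt0 ?expR_gt0.
have TP' : c * expR (A * s) <= P.
  by apply: le_trans TP; rewrite ler_peMr ?(ltW cE0).
have lnP : A / 2 * s <= ln (m + P).
  apply: (@le_trans _ _ (ln (c * expR (A * s)))); last first.
    by rewrite ler_ln ?posrE//; lra.
  rewrite lnM ?posrE ?expR_gt0// expRK.
  by move: sc; rewrite ler_pdivrMr// ; lra.
rewrite -[b - delta]opprB powRN invrK.
have db0 : 0 <= delta - b by lra.
apply: (@le_trans _ _ (c * expR (A * s) * s `^ b * (A / 2 * s) `^ (delta - b))).
  rewrite (@powRM _ (A / 2) s) ?divr_ge0 ?(ltW A0) ?(ltW s0)//.
  rewrite (@powRB _ s delta b); last by rewrite (gt_eqF s0) implybT.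
  rewrite le_eqVlt; apply/orP; left; apply/eqP.
  by field; rewrite !gt_eqF ?powR_gt0 ?expR_gt0.
have As0 : 0 <= A / 2 * s by rewrite mulr_ge0 ?divr_ge0 ?(ltW A0) ?(ltW s0).
rewrite ler_pM ?powR_ge0 ?mulr_ge0 ?(ltW cE0) ?powR_ge0 ?expR_ge0 ?(ltW c0)//.
by rewrite ge0_ler_powR ?nnegrE// (le_trans As0).
Qed.

(** The factor [expR (A * eps * s)] is weakened to [s `^ (A * eps)], so that the
    gains due to [eps] and to [delta] merge into a single power of [s]. *)
Lemma powR_div_ln_ge b delta A c m q eps N :
  0 <= b -> 0 < A -> 0 < c -> 1 <= m -> 0 <= q -> 0 <= eps ->
  A * q = N + A * eps ->
  exists c' K, [/\ 0 < c', 1 <= K & forall s P, K <= s ->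
    c * expR (A * s) * s `^ b <= P ->
    c' * (expR (N * s) * s `^ (A * eps + delta * q)) <=
    (P / ln (m + P) `^ (b - delta)) `^ q].
Proof.
move=> b0 A0 c0 m1 q0 e0 AqE.
have [c1 [K [c10 K1 HK]]] := div_ln_ge delta b0 A0 c0 m1.
exists (c1 `^ q), K; split; [exact: powR_gt0|by []|move=> s P Ks TP].
have s0 : 0 < s by lra.
have lhs0 : 0 <= c1 * (expR (A * s) * s `^ delta).
  by rewrite !mulr_ge0 ?expR_ge0 ?powR_ge0 ?(ltW c10).
apply: (@le_trans _ _ ((c1 * (expR (A * s) * s `^ delta)) `^ q)); last first.
  have H := HK _ _ Ks TP.
  by rewrite ge0_ler_powR ?nnegrE// (le_trans lhs0).
rewrite powRM ?mulr_ge0 ?expR_ge0 ?powR_ge0 ?(ltW c10)//.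
rewrite powRM ?expR_ge0 ?powR_ge0// -expRM -powRrM mulrAC AqE.
rewrite ler_wpM2l ?powR_ge0// mulrDl expRD -mulrA ler_wpM2l ?expR_ge0//.
rewrite powRD; last by rewrite (gt_eqF s0) implybT.
rewrite ler_wpM2r ?powR_ge0// [_ * s]mulrC expRM.
rewrite ge0_ler_powR ?nnegrE ?expR_ge0 ?(ltW s0) ?mulr_ge0 ?(ltW A0)//.
by have := expR_ge1Dx s; lra.
Qed.

Lemma mulr_powR_eventually_ge c sigma M : 0 < c -> 0 < sigma ->
  \forall k \near \oo, M <= c * k%:R `^ sigma.
Proof.
move=> c0 s0; near=> k; apply: le_trans (ler_norm M) _.
rewrite mulrC -ler_pdivrMr//.
have y0 : 0 <= `|M| / c by rewrite divr_ge0 ?(ltW c0).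
rewrite -[leLHS]powRr1// -[X in _ `^ X](@mulVf _ sigma) ?gt_eqF// powRrM.
rewrite ge0_ler_powR ?nnegrE ?powR_ge0 ?(ltW s0)//.
by near: k; exact: nbhs_infty_ger.
Unshelve. all: by end_near. Qed.

End growth.

(** * Blow-up of the integral *)

Theorem theorem7p5 (R : realType) (n : nat) (eps delta beta alpha p m : R)
  (hn : (2 <= n)%N)
  (heps : 0 <= eps) (hdelta : 0 <= delta) (hbeta : 0 <= beta)
  (halpha : 1 <= alpha < 1 + (n%:R - 1)^-1)
  (hp : 1 <= p < n%:R / (n%:R - alpha * (n%:R - 1)))
  (hm : expR 1 <= m)
  (hpos : 0 < eps \/ 0 < delta) :
  exists (C : R) (u : nat -> Rn R n -> R),
    (forall k, u k \in Lfun (lebesgue_Rn n) p%:E /\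
       ('N[lebesgue_Rn n]_p%:E[EFin \o u k] <= C%:E)%E) /\
    (Hintegral alpha beta delta eps p m (u k) @[k --> \oo] --> +oo%E).
Proof.
have n0 : (0 < n)%N by exact: leq_trans hn.
have n2 : 2 <= n%:R :> R by rewrite ler_nat.
have /andP[a1 a2] := halpha; have /andP[p1 p2] := hp.
have p0 : 0 < p by lra.
(* The denominator in the bound on [p] is positive, and the bound says
   [0 < D]. *)
have an : alpha * (n%:R - 1) < n%:R.
  have n10 : 0 < n%:R - 1 :> R by lra.
  move: a2; rewrite -ltrBlDl -(ltr_pM2r n10) mulVf ?gt_eqF//; lra.
pose D := alpha * p * (n%:R - 1) + n%:R * (1 - p).
have D0 : 0 < D by move: p2; rewrite ltr_pdivlMr /D; lra.
pose A := D / p.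
have A0 : 0 < A by exact: divr_gt0.
pose q := n%:R * p / D + eps.
have q0 : 0 < q by rewrite ltr_wpDr// divr_gt0// mulr_gt0//; lra.
have AqE : A * q = n%:R + A * eps.
  by rewrite /A /q; field; rewrite !gt_eqF.
pose b := beta * (n%:R - 1).
have b0 : 0 <= b by rewrite mulr_ge0//; lra.
have m1 : 1 <= m by have := expR_ge1Dx (1 : R); lra.
pose w : R := ((2 * n%:R)^-1) ^+ n.
have w0 : 0 < w by rewrite exprn_gt0// invr_gt0; lra.
pose c1 := w `^ (- p^-1) * w.
have c10 : 0 < c1 by rewrite mulr_gt0// powR_gt0.
have [c2 [K [c20 K1 HK]]] :=
  powR_div_ln_ge delta b0 A0 c10 m1 (ltW q0) heps AqE.
pose l (s : R) := expR (- s) / (2 * n%:R).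
have l0 s : 0 < l s by rewrite divr_gt0 ?expR_gt0//; lra.
pose c s := (l s ^+ n) `^ (- p^-1).
have c0 s : 0 <= c s by exact: powR_ge0.
exists 1, (fun k => bump (c k%:R) (l k%:R)); split=> [k|].
  split; first by rewrite Lfun_bump// ltW.
  rewrite Lnorm_bump// ?(ltW (l0 _))// lee_fin /c -powRD.
    by rewrite addNr powRr0.
  by apply/implyP => _; rewrite gt_eqF// exprn_gt0.
apply/cvgeyPge => M.
have sig0 : 0 < A * eps + delta * q.
  case: hpos => h.
    by apply: ltr_pwDl; [exact: mulr_gt0|rewrite mulr_ge0// ltW].
  by apply: ltr_wpDl; [rewrite mulr_ge0// ltW|exact: mulr_gt0].
near=> k.
have Ks : K <= k%:R by near: k; exact: nbhs_infty_ger.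
have Mk : M <= c2 * w * k%:R `^ (A * eps + delta * q).
  by near: k; apply: mulr_powR_eventually_ge => //; exact: mulr_gt0.
set s : R := k%:R in Ks Mk *.
have s1 : 1 <= s by lra.
have s0 : 0 < s by lra.
(* [v] bounds the integrand from below on the reflected cube. *)
pose v := c2 * (expR (n%:R * s) * s `^ (A * eps + delta * q)).
have v0 : 0 <= v by rewrite !mulr_ge0 ?expR_ge0 ?powR_ge0 ?(ltW c20).
apply: (@le_trans _ _ (v%:E * lebesgue_Rn n (cube (- l s) 0))%E).
  rewrite [X in (_ * X)%E](@lebesgue_cube _ _ (- l s) 0); last first.
    by rewrite oppr_le0 ltW.
  rewrite sub0r opprK -EFinM lee_fin /l exprMn -expRM_natl -/w.
  rewrite [leRHS](_ : _ = c2 * w * s `^ (A * eps + delta * q)); last first.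
    have eE : expR (n%:R * s) * expR (n%:R * - s) = 1.
      by rewrite -expRD mulrN subrr expR0.
    by rewrite -[RHS]mulr1 -[in RHS]eE /v; ring.
  exact: Mk.
apply: ge0_integral_ge_cst => //.
- exact: measurable_cube.
- move=> x; have := potential_ge0 alpha beta (bump (c s) (l s)) x.
  by case: potential => [P| |]//= _; rewrite ?lee_fin ?powR_ge0 ?leey.
move=> x xQ.
have a0 : 0 <= alpha by lra.
have := potential_bump_ge n0 a0 hbeta (c0 s) s1 xQ.
rewrite [X in (X%:E <= _)%E -> _](bump_height _ _ n0 p1 s0).
case: potential => [P| |]//=; rewrite ?leey// !lee_fin => TP.
exact: HK.
Unshelve. all: by end_near. Qed.
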